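(* Let $A,B:\mathbb{R}^n\rightrightarrows\mathbb{R}^n$ and $\mu_A,\rho_A,\mu_B,\rho_B\in\mathbb{R}$. Pointwise version: suppose $A$ is $(\mu_A,\rho_A)$-semimonotone at $(x'_A,y'_A)\in\operatorname{gph}A$ and $B$ is $(\mu_B,\rho_B)$-semimonotone at $(x'_B,y'_B)\in\operatorname{gph}B$. Then: (i) if $x':=x'_A=x'_B$, then $A+B$ is $(\mu_A+\mu_B,\rho_A\Box\rho_B)$-semimonotone at $(x',y'_A+y'_B)$ if either $\rho_A+\rho_B>0$ or $\rho_A=\rho_B=0$; (ii) if $y':=y'_A=y'_B$, then $A\Box B$ is $(\mu_A\Box\mu_B,\rho_A+\rho_B)$-semimonotone at $(x'_A+x'_B,y')$ if either $\mu_A+\mu_B>0$ or $\mu_A=\mu_B=0$. Global version: suppose $A$ is $(\mu_A,\rho_A)$-semimonotone and $B$ is $(\mu_B,\rho_B)$-semimonotone. Then: (i) $A+B$ is $(\mu_A+\mu_B,\rho_A\Box\rho_B)$-semimonotone if either $\rho_A+\rho_B>0$ or $\rho_A=\rho_B=0$; (ii) $A\Box B$ is $(\mu_A\Box\mu_B,\rho_A+\rho_B)$-semimonotone if either $\mu_A+\mu_B>0$ or $\mu_A=\mu_B=0$.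
   Context: $\operatorname{gph}A=\{(x,y):y\in Ax\}$. $A$ is $(\mu,\rho)$-semimonotone at $(x',y')\in\operatorname{gph}A$ if $\langle x-x',y-y'\rangle\ge\mu\|x-x'\|^2+\rho\|y-y'\|^2$ for all $(x,y)\in\operatorname{gph}A$; it is $(\mu,\rho)$-semimonotone if this holds at all $(x',y')\in\operatorname{gph}A$. Parallel sum of operators: $A\Box B:=(A^{-1}+B^{-1})^{-1}$. Parallel sum of reals: $a\Box b=0$ if $a=b=0$, and $a\Box b=\frac{ab}{a+b}$ if $a+b\ne0$. *)

(* Defs.v *)
From mathcomp Require Import all_boot all_order all_algebra.
From mathcomp Require Import all_classical all_reals.

Set Implicit Arguments.
Unset Strict Implicit.
Unset Printing Implicit Defensive.

Import Order.TTheory GRing.Theory Num.Theory.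
Local Open Scope classical_set_scope.
Local Open Scope ring_scope.

Definition dot (R : realType) (n : nat) (x y : 'cV[R]_n) : R :=
  \sum_(i < n) x i 0 * y i 0.

(* The norm that MathComp-Analysis puts on matrices is the sup norm, hence
   this explicit Euclidean one. *)
Definition enorm (R : realType) (n : nat) (x : 'cV[R]_n) : R :=
  Num.sqrt (dot x x).

Definition operator (R : realType) (n : nat) : Type :=
  'cV[R]_n -> set 'cV[R]_n.

Definition gph (R : realType) (n : nat) (A : operator R n) :
    set ('cV[R]_n * 'cV[R]_n) :=
  [set p | A p.1 p.2].

Definition inv_op (R : realType) (n : nat) (A : operator R n) : operator R n :=
  fun y => [set x | gph A (x, y)].

Definition add_op (R : realType) (n : nat) (A B : operator R n) :
    operator R n :=
  fun x => [set u + v | u in A x & v in B x].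

Definition parsum_op (R : realType) (n : nat) (A B : operator R n) :
    operator R n :=
  inv_op (add_op (inv_op A) (inv_op B)).

(* Meaningful only when a = b = 0 or a + b != 0; in the remaining case
   a = - b != 0 the value is a junk one. *)
Definition parsum (R : realType) (a b : R) : R :=
  if (a == 0) && (b == 0) then 0 else a * b / (a + b).

(* Being semimonotone at a point includes that the point is in the graph. *)
Definition semimonotone_at (R : realType) (n : nat) (mu rho : R)
    (A : operator R n) (p : 'cV[R]_n * 'cV[R]_n) : Prop :=
  gph A p /\
  forall x y : 'cV[R]_n, gph A (x, y) ->
    mu * enorm (x - p.1) ^+ 2 + rho * enorm (y - p.2) ^+ 2
      <= dot (x - p.1) (y - p.2).

Definition semimonotone (R : realType) (n : nat) (mu rho : R)
    (A : operator R n) : Prop :=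
  forall p, gph A p -> semimonotone_at mu rho A p.

(* Main.v *)
Require Import Defs.
From mathcomp Require Import all_boot all_order all_algebra.
From mathcomp Require Import all_classical all_reals.
From mathcomp Require Import ring lra.
Import Order.TTheory GRing.Theory Num.Theory.
Local Open Scope ring_scope.

(** When [a + b > 0], minimising [a |u|^2 + b |v|^2] over all decompositions
    [w = u + v] of a given vector gives exactly [(a b / (a + b)) |w|^2]; the
    parallel sum of two reals is this optimal value ([parsum_enorm_le]).  When
    [a = b = 0] both sides vanish.
    For [A + B], fix the common first argument [x]: adding the semimonotonicity
    inequalities of [A] and [B] sums the inner products and the [mu]-terms, and
    leaves [rhoA |u|^2 + rhoB |v|^2], where [u] and [v] are the increments of
    the two outputs.  The bound above converts this into a multiple of
    [|u + v|^2] ([semimonotone_at_add]).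
    Passing to the inverse operator swaps the two variables, hence the two
    moduli ([semimonotone_at_inv]), and the parallel sum of operators is the
    sum conjugated by inversion; so the claims on the parallel sum are those
    on the sum for the inverses.  The global claims follow because every point
    of the graph of a sum splits into points of the two graphs over the same
    argument. *)

Lemma dotC (R : realType) (n : nat) (x y : 'cV[R]_n) : dot x y = dot y x.
Proof. by apply: eq_bigr => i _; rewrite mulrC. Qed.

Lemma dotDr (R : realType) (n : nat) (x y z : 'cV[R]_n) :
  dot x (y + z) = dot x y + dot x z.
Proof. by rewrite -big_split; apply: eq_bigr => i _; rewrite !mxE mulrDr. Qed.

Lemma enorm_sqr (R : realType) (n : nat) (x : 'cV[R]_n) :
  enorm x ^+ 2 = dot x x.
Proof. by rewrite sqr_sqrtr //; apply: sumr_ge0 => i _; exact: sqr_ge0. Qed.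

(** When [a + b > 0], the gap between the two sides is [(a u - b v)^2 / (a + b)]. *)
Lemma parsum_sqr_le (R : realType) (a b u v : R) :
  0 < a + b \/ (a = 0 /\ b = 0) ->
  parsum a b * (u + v) ^+ 2 <= a * u ^+ 2 + b * v ^+ 2.
Proof.
rewrite /parsum; case=> [ab_gt0 | [-> ->]]; last by rewrite eqxx /= !mul0r addr0.
case: ifP => [/andP[/eqP a0 /eqP b0] | _].
  by move: ab_gt0; rewrite a0 b0 addr0 ltxx.
rewrite -subr_ge0.
have -> : a * u ^+ 2 + b * v ^+ 2 - a * b / (a + b) * (u + v) ^+ 2 =
          (a * u - b * v) ^+ 2 / (a + b).
  by field; rewrite gt_eqF.
by rewrite divr_ge0 ?sqr_ge0 // ltW.
Qed.

Lemma parsum_enorm_le (R : realType) (n : nat) (a b : R) (u v : 'cV[R]_n) :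
  0 < a + b \/ (a = 0 /\ b = 0) ->
  parsum a b * enorm (u + v) ^+ 2 <= a * enorm u ^+ 2 + b * enorm v ^+ 2.
Proof.
move=> ab; rewrite !enorm_sqr /dot !mulr_sumr -big_split /=.
by apply: ler_sum => i _; rewrite !mxE -!expr2; exact: parsum_sqr_le.
Qed.

Lemma semimonotone_at_add (R : realType) (n : nat) (A B : operator R n)
    (muA rhoA muB rhoB : R) (x yA yB : 'cV[R]_n) :
  0 < rhoA + rhoB \/ (rhoA = 0 /\ rhoB = 0) ->
  semimonotone_at muA rhoA A (x, yA) -> semimonotone_at muB rhoB B (x, yB) ->
  semimonotone_at (muA + muB) (parsum rhoA rhoB) (add_op A B) (x, yA + yB).
Proof.
move=> rho_ok [gA smA] [gB smB]; split; first by exists yA => //; exists yB.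
move=> z w [u Au [v Bv /= <-]].
have := smA z u Au; have := smB z v Bv.
have := @parsum_enorm_le R n _ _ (u - yA) (v - yB) rho_ok.
rewrite /= (_ : u + v - (yA + yB) = (u - yA) + (v - yB)); last first.
  by rewrite opprD addrACA.
by rewrite (dotDr _ _ _ (u - yA)); lra.
Qed.

(** The defining inequality is symmetric under exchanging the two variables
    together with their moduli. *)
Lemma semimonotone_at_inv (R : realType) (n : nat) (A : operator R n)
    (mu rho : R) (x y : 'cV[R]_n) :
  semimonotone_at mu rho A (x, y) -> semimonotone_at rho mu (inv_op A) (y, x).
Proof.
by case=> gA smA; split=> // z w /smA /=; rewrite dotC addrC.
Qed.

Lemma semimonotone_inv (R : realType) (n : nat) (A : operator R n)
    (mu rho : R) :
  semimonotone mu rho A -> semimonotone rho mu (inv_op A).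
Proof. by move=> smA [y x] gA; apply: semimonotone_at_inv; exact: smA. Qed.

Lemma semimonotone_add (R : realType) (n : nat) (A B : operator R n)
    (muA rhoA muB rhoB : R) :
  0 < rhoA + rhoB \/ (rhoA = 0 /\ rhoB = 0) ->
  semimonotone muA rhoA A -> semimonotone muB rhoB B ->
  semimonotone (muA + muB) (parsum rhoA rhoB) (add_op A B).
Proof.
move=> rho_ok smA smB [x w] [u Au [v Bv /= <-]].
by apply: semimonotone_at_add => //; [exact: smA | exact: smB].
Qed.

Theorem proposition4p7 (R : realType) (n : nat) (A B : operator R n)
    (muA rhoA muB rhoB : R) :
  (forall xA yA xB yB : 'cV[R]_n,
     semimonotone_at muA rhoA A (xA, yA) ->
     semimonotone_at muB rhoB B (xB, yB) ->
     (forall x' : 'cV[R]_n, x' = xA -> x' = xB ->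
        0 < rhoA + rhoB \/ (rhoA = 0 /\ rhoB = 0) ->
        semimonotone_at (muA + muB) (parsum rhoA rhoB)
          (add_op A B) (x', yA + yB)) /\
     (forall y' : 'cV[R]_n, y' = yA -> y' = yB ->
        0 < muA + muB \/ (muA = 0 /\ muB = 0) ->
        semimonotone_at (parsum muA muB) (rhoA + rhoB)
          (parsum_op A B) (xA + xB, y')))
  /\
  (semimonotone muA rhoA A ->
   semimonotone muB rhoB B ->
   (0 < rhoA + rhoB \/ (rhoA = 0 /\ rhoB = 0) ->
      semimonotone (muA + muB) (parsum rhoA rhoB) (add_op A B)) /\
   (0 < muA + muB \/ (muA = 0 /\ muB = 0) ->
      semimonotone (parsum muA muB) (rhoA + rhoB) (parsum_op A B))).
Proof.
split=> [xA yA xB yB smA smB | smA smB]; split.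
- by move=> _ -> eqx rho_ok; rewrite -eqx in smB; exact: semimonotone_at_add.
- move=> _ -> eqy mu_ok; rewrite -eqy in smB.
  apply: semimonotone_at_inv.
  by apply: semimonotone_at_add => //; exact: semimonotone_at_inv.
- by move=> rho_ok; exact: semimonotone_add.
- move=> mu_ok; apply: semimonotone_inv.
  by apply: semimonotone_add => //; exact: semimonotone_inv.
Qed.
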